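(* Let $\bar\gamma_{\mathrm{R}},\bar\gamma_{\mathrm{D}},\bar\gamma_{\mathrm{E}}>0$ and $\mathcal{R}>0$. Let $h_{\mathrm{S},\mathrm{R}},h_{\mathrm{R},\mathrm{D}},h_{\mathrm{S},\mathrm{E}},h_{\mathrm{R},\mathrm{E}}$ be independent $\mathcal{CN}(0,1)$ random variables. Define $$\mathcal{R}^{3}_{\mathrm{S}\to\mathrm{R}}=\log_2\frac{1+\bar\gamma_{\mathrm{R}}|h_{\mathrm{S},\mathrm{R}}|^2}{1+\bar\gamma_{\mathrm{E}}|h_{\mathrm{S},\mathrm{E}}|^2},\qquad \mathcal{R}^{3}_{\mathrm{R}\to\mathrm{D}}=\log_2\frac{1+\bar\gamma_{\mathrm{D}}|h_{\mathrm{R},\mathrm{D}}|^2}{1+\bar\gamma_{\mathrm{E}}|h_{\mathrm{R},\mathrm{E}}|^2},$$ $\mathcal{R}_3=\max\{\min\{\mathcal{R}^{3}_{\mathrm{S}\to\mathrm{R}},\mathcal{R}^{3}_{\mathrm{R}\to\mathrm{D}}\},0\}$ and $\mathcal{P}_3=\Pr(\mathcal{R}_3<\mathcal{R})$. Then $$\mathcal{P}_3=1-\mathrm{e}^{-\frac{2^{\mathcal{R}}-1}{\bar\gamma_{\mathrm{D}}}-\frac{2^{\mathcal{R}}-1}{\bar\gamma_{\mathrm{R}}}}\cdot\frac{1}{1+\frac{2^{\mathcal{R}}}{\bar\gamma_{\mathrm{D}}}\bar\gamma_{\mathrm{E}}}\cdot\frac{1}{1+\frac{2^{\mathcal{R}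}}{\bar\gamma_{\mathrm{R}}}\bar\gamma_{\mathrm{E}}}.$$
   Context: This models a decode-and-forward relay system (source S, relay R, destination D, eavesdropper E) where the eavesdropper overhears both the source's and the relay's transmissions. $\mathcal{CN}(0,1)$ denotes a circularly symmetric complex Gaussian random variable with zero mean and unit variance (Rayleigh fading). $\bar\gamma$'s are average SNRs, $\mathcal{R}_3$ the secrecy capacity and $\mathcal{P}_3$ the secrecy outage probability. *)

(* Defs.v *)
From HB Require Import structures.
From mathcomp Require Import all_boot all_order all_algebra.
From mathcomp Require Import all_classical all_reals all_analysis.
Set Implicit Arguments. Unset Strict Implicit. Unset Printing Implicit Defensive.
Import Order.TTheory GRing.Theory Num.Theory.
Local Open Scope classical_set_scope.
Local Open Scope ring_scope.

Definition iSR : 'I_4 := @Ordinal 4 0 isT.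
Definition iRD : 'I_4 := @Ordinal 4 1 isT.
Definition iSE : 'I_4 := @Ordinal 4 2 isT.
Definition iRE : 'I_4 := @Ordinal 4 3 isT.

(* A complex random variable h_k is given by its real and imaginary parts
   hre k, him k : T -> R, so |h_k|^2 = hre k ^2 + him k ^2. *)
Definition abs2 {d} {T : measurableType d} {R : realType}
  (hre him : 'I_4 -> T -> R) (k : 'I_4) (t : T) : R :=
  hre k t ^+ 2 + him k t ^+ 2.

(* h_0,...,h_3 are independent CN(0,1) random variables: all 8 real
   components are measurable and their joint law is the product of
   N(0,1/2) laws (real and imaginary parts i.i.d. N(0,1/2), standard
   deviation sqrt(1/2)); this is exactly "independent CN(0,1)". *)
Definition indep_CN01 {d} {T : measurableType d} {R : realType}
  (P : probability T R) (hre him : 'I_4 -> T -> R) : Prop :=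
  (forall k, measurable_fun setT (hre k)) /\
  (forall k, measurable_fun setT (him k)) /\
  forall A B : 'I_4 -> set R,
    (forall k, measurable (A k)) -> (forall k, measurable (B k)) ->
    P (\bigcap_(k in [set: 'I_4]) (hre k @^-1` A k `&` him k @^-1` B k)) =
    (\prod_(k < 4) (normal_prob 0 (Num.sqrt (2^-1 : R)) (A k) *
                    normal_prob 0 (Num.sqrt (2^-1 : R)) (B k)))%E.

Definition log2 {R : realType} (x : R) : R := ln x / ln 2.

Definition secrecy_R3 {d} {T : measurableType d} {R : realType}
  (gR gD gE : R) (hre him : 'I_4 -> T -> R) (t : T) : R :=
  let RSR := log2 ((1 + gR * abs2 hre him iSR t) / (1 + gE * abs2 hre him iSE t)) in
  let RRD := log2 ((1 + gD * abs2 hre him iRD t) / (1 + gE * abs2 hre him iRE t)) in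
  Num.max (Num.min RSR RRD) 0.

(* Main.v *)
Require Import Defs.
From HB Require Import structures.
From mathcomp Require Import all_boot all_order all_algebra.
From mathcomp Require Import all_classical all_reals all_analysis.
From mathcomp Require Import measurable_realfun ring.
Import Order.TTheory GRing.Theory Num.Theory.
Import numFieldNormedType.Exports.
Local Open Scope classical_set_scope.
Local Open Scope ring_scope.

(* There is no outage exactly when both hops satisfy |h|^2 >= a + b |h'|^2 with
   a = (2^Rs - 1) / g and b = 2^Rs gE / g, where h is the legitimate channel
   and h' the eavesdropper's one.  Conditioning on h', the probability of this
   is E[exp (- (a + b |h'|^2))] = exp (- a) / (1 + b), since |h|^2 is
   exponential of rate 1.  The latter is obtained without polar coordinates:
   substituting y = x u in the integral of exp (- (x^2 + y^2)) over
   x^2 + y^2 >= s and exchanging the integrals gives exp (- s) times a constant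
   independent of s, which must be 1 because of the case s = 0. *)

(** * Scaling and reflection in Lebesgue integrals on the line *)

Section lebesgue_integral_scaling.
Context {R : realType}.
Local Notation mu := (@lebesgue_measure R).

(** Uniqueness of Lebesgue measure: the right-hand side is a measure in [A], and it gives []a, b]]
    the value [k * (b / k - a / k) = b - a]. *)
Lemma lebesgue_measure_scale (k : R) (A : set R) : 0 < k -> measurable A ->
  mu A = (k%:E * mu ( *%R k @^-1` A))%E.
Proof.
move=> k0 mA.
pose f := ( *%R k : measurableTypeR R -> measurableTypeR R).
have mk : measurable_fun [set: measurableTypeR R] f by exact: measurable_funM.
have [m mE] : {m : {measure set (measurableTypeR R) -> \bar R} |
    forall B, m B = (k%:E * mu (f @^-1` B))%E}.
  by unshelve eexists (mscale (NngNum (ltW k0)) (pushforward mu f)).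
rewrite -mE.
apply: lebesgue_measure_unique mA => //= _ [[a b]] _ <-; rewrite mE.
have -> : f @^-1` `]a, b] = `]a / k, b / k]%classic.
  apply/seteqP; split => x; rewrite /f/= !in_itv/= ltr_pdivrMr//.
    by rewrite ler_pdivlMr// (mulrC x).
  by rewrite ler_pdivlMr// (mulrC x).
rewrite !lebesgue_measure_itv/= !lte_fin ltr_pM2r ?invr_gt0//.
case: ifPn => _; last by rewrite mule0.
by rewrite -!EFinB -EFinM; congr EFin; field; rewrite gt_eqF.
Qed.

(** Lebesgue measure is [k] times its pushforward under multiplication by [k], so the change of
    variables reduces to integration against a pushforward. *)
Lemma ge0_integral_scale (k : R) (f : R -> \bar R) : 0 < k ->
  measurable_fun setT f -> (forall x, 0 <= f x)%E ->
  (\int[mu]_x f x = k%:E * \int[mu]_x f (k * x)%R)%E.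
Proof.
move=> k0 mf f0.
pose g := ( *%R k : measurableTypeR R -> measurableTypeR R).
have mk : measurable_fun [set: measurableTypeR R] g by exact: measurable_funM.
have [m mE] : {m : {measure set (measurableTypeR R) -> \bar R} |
    (m : set _ -> _) = pushforward mu g} by unshelve eexists (pushforward mu g).
transitivity (\int[mscale (NngNum (ltW k0)) m]_x f x)%E.
  apply: eq_measure_integral => /= A mA _.
  by rewrite /mscale/= mE; exact: lebesgue_measure_scale.
rewrite ge0_integral_mscale//=; congr (_ * _)%E.
by rewrite mE ge0_integral_pushforward.
Qed.

(** Reflection sends the negative half-line to the positive one; the point 0 is null, so open and
    closed ends may be exchanged. *)
Lemma ge0_even_integralT (f : R -> \bar R) :
  measurable_fun setT f -> (forall x, 0 <= f x)%E -> (forall x, f (- x) = f x) ->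
  (\int[mu]_x f x = 2%:E * \int[mu]_(x in `]0%R, +oo[) f x)%E.
Proof.
move=> mf f0 fN.
have mfD D : measurable_fun D f by exact: measurable_funTS.
rewrite -(setUv `[0%R, +oo[%classic) ge0_integral_setU//=; last 3 first.
  exact: measurableC.
  exact: mfD.
  exact/disj_setPCl.
rewrite setCitvr integral_itv_bndo_bndc; last exact: mfD.
have := ge0_integration_by_substitution0 mf f0.
under [X in _ = X -> _]eq_integral do rewrite fN.
move=> <-; rewrite -integral_itv_obnd_cbnd; last exact: mfD.
by rewrite mule_natl mule2n.
Qed.

End lebesgue_integral_scaling.

(** * Integrals against normal laws *)

Section normal_integral.
Context {R : realType}.
Local Notation mu := (@lebesgue_measure R).

(** The density agrees almost everywhere with the Radon-Nikodym derivative of the law, since both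
    have the same integral over every measurable set. *)
Lemma integral_normal_prob (m s : R) (f : R -> \bar R) :
  (normal_prob m s).-integrable setT f ->
  (\int[normal_prob m s]_x f x = \int[mu]_x (f x * (normal_pdf m s x)%:E))%E.
Proof.
move=> intf; have mf := measurable_int _ intf.
have mpdf : measurable_fun setT (EFin \o normal_pdf m s).
  by apply/measurable_EFinP; exact: measurable_normal_pdf.
rewrite -(Radon_Nikodym_change_of_variables (normal_prob_dominates m s))//=.
apply: ae_eq_integral => //.
- apply: emeasurable_funM => //; apply: (measurable_int mu).
  by apply: Radon_Nikodym_integrable; exact: normal_prob_dominates.
- exact: emeasurable_funM.
- apply: ae_eqe_mul2l => /=.
  rewrite Radon_NikodymE//=; first exact: normal_prob_dominates.
  move=> dom; case: cid => /= h [h1 h2 h3].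
  apply: integral_ae_eq => //= E _ mE.
  by rewrite -h3.
Qed.

(** The factor [y], later supplied by the Jacobian of a substitution, gives the integrand an
    elementary antiderivative. *)
Lemma integral_expRsqr_tail (k s : R) : 0 < k -> 0 <= s ->
  (\int[mu]_(y in `]0%R, +oo[)
     (y * expR (- (k * y ^+ 2)) * \1_`[s, +oo[ (k * y ^+ 2))%:E =
   (expR (- s) / (2 * k))%:E)%E.
Proof.
move=> k0 s0.
(* On the positive half-line [k * y ^+ 2] reaches [s] exactly at [r], so the indicator cuts the
   domain down to [[r, +oo[]. *)
pose r := Num.sqrt (s / k).
have r0 : 0 <= r by exact: sqrtr_ge0.
have kr : k * r ^+ 2 = s.
  rewrite sqr_sqrtr; last by rewrite divr_ge0// ltW.
  by field; rewrite gt_eqF.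
have mg : measurable_fun setT (fun y : R => y * expR (- (k * y ^+ 2))).
  apply: measurable_funM => //; apply: measurableT_comp => //.
  by apply: measurableT_comp => //; exact: measurable_funM.
have mf : measurable_fun setT
    (fun y : R => y * expR (- (k * y ^+ 2)) * \1_`[s, +oo[ (k * y ^+ 2)).
  apply: measurable_funM => //.
  by apply: measurableT_comp => //; exact: measurable_funM.
rewrite integral_itv_obnd_cbnd; last first.
  exact/measurable_EFinP/measurable_funTS.
transitivity (\int[mu]_(y in `[r, +oo[) (y * expR (- (k * y ^+ 2)))%:E)%E.
  have -> : `[r, +oo[%classic = `[0%R, +oo[ `&` `[r, +oo[ :> set R.
    rewrite setIidr// => x /=; rewrite !in_itv/= !andbT; exact: le_trans.
  rewrite integral_mkcondr; apply: eq_integral => y.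
  rewrite inE/= in_itv/= andbT => y0.
  rewrite patchE indicE.
  have -> : (k * y ^+ 2 \in `[s, +oo[%classic) = (y \in `[r, +oo[%classic).
    rewrite !mem_setE !in_itv/= !andbT -kr ler_pM2l//.
    by rewrite ler_pXn2r// nnegrE.
  by case: ifPn => _; rewrite ?mulr1 ?mulr0.
pose F (y : R) := - (expR (- (k * y ^+ 2)) / (2 * k)).
have dF (y : R) : is_derive y 1 F (y * expR (- (k * y ^+ 2))).
  have h : is_derive y 1 (fun y => - (k * y ^+ 2)) (- (k * (2 * y))).
    apply: is_derive_eq.
    by rewrite -mulr2n [y%:A]mulr1 mulr_natl.
  have h2 := is_derive1_comp (is_derive_expR _) h.
  have -> : F = (fun y => - (2 * k)^-1 *: (expR \o (fun y => - (k * y ^+ 2))) y).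
    by apply/funext => z; rewrite /F /GRing.scale/= mulNr mulrC.
  apply: is_derive_eq.
  by rewrite /GRing.scale/=; field; rewrite gt_eqF.
have cE : continuous (fun y : R => expR (- (k * y ^+ 2))).
  move=> x; apply: (@continuous_comp _ _ _ (fun x : R => - (k * x ^+ 2)) expR).
    apply: cvgN; apply: cvgM; [exact: cvg_cst|exact: exprn_continuous].
  exact: continuous_expR.
have Fy : F y @[y --> +oo] --> (0 : R).
  rewrite -oppr0 -(mul0r (2 * k)^-1).
  apply: cvgN; apply: cvgM; last exact: cvg_cst.
  apply: (cvg_comp (fun x : R => k * x ^+ 2) (fun x => expR (- x))).
    apply: gt0_cvgMry => //; exact: cvgr_expr2.
  exact: cvgr_expR.
rewrite (@ge0_continuous_FTC2y _ _ F r 0)//.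
- by rewrite /F kr -EFinB; congr EFin; rewrite sub0r opprK.
- by move=> x rx; rewrite mulr_ge0 ?expR_ge0// (le_trans r0).
- by apply: continuous_subspaceT => x; apply: cvgM; [exact: cvg_id|exact: cE].
- apply: cvg_at_right_filter; apply: cvgN; apply: cvgM; last exact: cvg_cst.
  exact: cE.
- by move=> x _; rewrite derive1E; apply: derive_val.
Qed.

(** Variance 1/2 makes the exponent exactly [- x ^+ 2]. *)
Lemma normal_pdf_sqrt_half (x : R) :
  normal_pdf 0 (Num.sqrt 2^-1) x = normal_peak (Num.sqrt 2^-1) * gauss_fun x.
Proof.
rewrite normal_pdfE ?gt_eqF ?sqrtr_gt0 ?invr_gt0// /normal_fun /gauss_fun.
rewrite subr0 sqr_sqrtr ?invr_ge0//; congr (_ * expR _).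
by field.
Qed.

(** The integrand times the density is again Gaussian, with its argument dilated by
    [Num.sqrt (1 + b)]; scaling compares it with the total mass 1. *)
Lemma integral_expRsqr_normal (b : R) : 0 <= b ->
  (\int[normal_prob 0 (Num.sqrt 2^-1)]_x (expR (- (b * x ^+ 2)))%:E =
   (Num.sqrt (1 + b))^-1%:E)%E.
Proof.
move=> b0.
have c0 : 0 < Num.sqrt (1 + b) by rewrite sqrtr_gt0 ltr_wpDr.
have mf : measurable_fun setT (fun x : R => expR (- (b * x ^+ 2))).
  by do 2 apply: measurableT_comp => //; exact: measurable_funM.
rewrite integral_normal_prob; last first.
  apply: (@le_integrable _ _ _ _ _ _ _ (cst 1%E)) => //.
  - exact/measurable_EFinP.
  - move=> x _ /=; rewrite normr1 ger0_norm ?expR_ge0// lee_fin.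
    by rewrite -[leRHS]expR0 ler_expR oppr_le0 mulr_ge0// sqr_ge0.
  - exact: finite_measure_integrable_cst.
transitivity ((normal_peak (Num.sqrt 2^-1))%:E *
    \int[mu]_x (gauss_fun (Num.sqrt (1 + b) * x))%:E)%E.
  rewrite -ge0_integralZl//=; last 3 first.
  - apply/measurable_EFinP; apply: measurableT_comp.
      exact: measurable_gauss_fun.
    exact: measurable_funM.
  - by move=> x _; rewrite lee_fin gauss_fun_ge0.
  - by rewrite lee_fin normal_peak_ge0.
  apply: eq_integral => x _; rewrite normal_pdf_sqrt_half -!EFinM; congr EFin.
  rewrite mulrCA; congr (_ * _); rewrite /gauss_fun -expRD; congr expR.
  by rewrite exprMn sqr_sqrtr; [ring|rewrite addr_ge0].
have g1 : ((normal_peak (Num.sqrt 2^-1))%:E * \int[mu]_x (gauss_fun x)%:E = 1)%E.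
  rewrite -(integral_normal_pdf 0 (Num.sqrt 2^-1)) -ge0_integralZl//=; last 3 first.
  - by apply/measurable_EFinP; exact: measurable_gauss_fun.
  - by move=> x _; rewrite lee_fin gauss_fun_ge0.
  - by rewrite lee_fin normal_peak_ge0.
  by apply: eq_integral => x _; rewrite normal_pdf_sqrt_half.
move: g1; rewrite (ge0_integral_scale (Num.sqrt (1 + b)))//; last 2 first.
- by apply/measurable_EFinP; exact: measurable_gauss_fun.
- by move=> x; rewrite lee_fin gauss_fun_ge0.
rewrite muleCA => g1.
by rewrite -[RHS]mule1 -g1 [RHS]muleA -EFinM mulVf ?mul1e ?lt0r_neq0.
Qed.

End normal_integral.

(** * The squared modulus of a standard complex Gaussian *)

Section complex_normal.
Context {R : realType}.
Local Notation mu := (@lebesgue_measure R).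
Local Notation sigma := (Num.sqrt (2^-1 : R)).
Local Notation N := (normal_prob 0 sigma).

Definition sqnorm (z : R * R) : R := z.1 ^+ 2 + z.2 ^+ 2.

Lemma measurable_sqnorm : measurable_fun setT sqnorm.
Proof. by apply: measurable_funD; apply: measurable_funX. Qed.

Lemma measurable_sqnorm_ge (s : R) : measurable [set z : R * R | s <= sqnorm z].
Proof.
have -> : [set z | s <= sqnorm z] = sqnorm @^-1` `[s, +oo[.
  by apply/seteqP; split => z/=; rewrite in_itv/= andbT.
by rewrite -[X in measurable X]setTI; exact: measurable_sqnorm.
Qed.

(** What matters is the factorisation: the integral in [u] is free of [s], and is left unevaluated
    until a comparison with total mass fixes it. *)
Lemma complex_normal_tailM (s : R) : 0 <= s ->
  ((N \x N) [set z | (s <= sqnorm z)%R] = (expR (- s))%:E *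
     (2%:E * \int[mu]_u (normal_peak sigma ^+ 2 / (2 * (1 + u ^+ 2)))%:E))%E.
Proof.
move=> s0.
pose K := normal_peak sigma.
have K0 : 0 <= K by exact: normal_peak_ge0.
(* For fixed [x], this is the density of the second coordinate restricted to the tail region; its
   integral is the measure of the section at [x]. *)
pose q (x y : R) := K * gauss_fun y * \1_`[s, +oo[ (x ^+ 2 + y ^+ 2).
have q0 x y : 0 <= q x y by rewrite !mulr_ge0// gauss_fun_ge0.
have mq2 : measurable_fun setT (fun z : R * R => q z.1 z.2).
  apply: measurable_funM; first apply: measurable_funM => //.
    by apply: measurableT_comp => //; exact: measurable_gauss_fun.
  by apply: measurableT_comp => //; exact: measurable_sqnorm.
have mq x : measurable_fun setT (q x).
  exact: measurableT_comp mq2 (pair1_measurable x).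
pose C : set (R * R) := [set z | s <= sqnorm z].
have mC : measurable C by exact: measurable_sqnorm_ge.
have NC x : N (xsection C x) = (\int[mu]_y (q x y)%:E)%E.
  rewrite /normal_prob integral_mkcond; apply: eq_integral => y _.
  rewrite patchE mem_xsection /q indicE normal_pdf_sqrt_half.
  have -> : ((x, y) \in C) = (s <= x ^+ 2 + y ^+ 2) by apply/idP/idP; rewrite inE.
  rewrite mem_setE in_itv/= andbT.
  by case: ifPn; rewrite ?mulr1 ?mulr0.
pose f x := (\int[mu]_y (q x y)%:E * (K * gauss_fun x)%:E)%E.
have mf : measurable_fun setT f.
  apply: emeasurable_funM.
    apply: (@measurable_fun_fubini_tonelli_F _ _ _ _ _ mu (fun z => (q z.1 z.2)%:E)).
    - exact/measurable_EFinP.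
    - by move=> z; rewrite lee_fin.
  apply/measurable_EFinP; apply: measurable_funM => //.
  exact: measurable_gauss_fun.
have f0 x : (0 <= f x)%E.
  rewrite mule_ge0 ?lee_fin ?mulr_ge0 ?gauss_fun_ge0//.
  by apply: integral_ge0 => y _; rewrite lee_fin.
have step1 : ((N \x N) C = \int[mu]_x f x)%E.
  rewrite /product_measure1 integral_normal_prob; last first.
    apply: (@le_integrable _ _ _ _ _ _ _ (cst 1%E)) => //.
    - exact: measurable_fun_xsection.
    - move=> x _ /=; rewrite normr1 gee0_abs//.
      by apply: probability_le1; exact: measurable_xsection.
    - exact: finite_measure_integrable_cst.
  by apply: eq_integral => x _ /=; rewrite NC normal_pdf_sqrt_half.
(* Evenness allows restricting to [x > 0], where the substitution [y = x * u] is a dilation by a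
   positive factor. *)
have fN x : f (- x) = f x.
  by rewrite /f /q /gauss_fun sqrrN.
(* After [y = x * u], the squared norm is [(1 + u ^+ 2) * x ^+ 2], and the leading [x] is the
   Jacobian. *)
pose g (u x : R) := x * expR (- ((1 + u ^+ 2) * x ^+ 2)) *
                      \1_`[s, +oo[ ((1 + u ^+ 2) * x ^+ 2).
have step2 x : 0 < x -> f x = (\int[mu]_u (K ^+ 2 * g u x)%:E)%E.
  move=> x0; rewrite /f (ge0_integral_scale x)//; last 2 first.
  - exact/measurable_EFinP.
  - by move=> y; rewrite lee_fin.
  rewrite -muleA muleC -muleA -EFinM -ge0_integralZr//.
  - apply: eq_integral => u _; rewrite -EFinM; congr EFin.
    rewrite /q /g /gauss_fun.
    have -> : x ^+ 2 + (x * u) ^+ 2 = (1 + u ^+ 2) * x ^+ 2 by ring.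
    have -> : - ((1 + u ^+ 2) * x ^+ 2) = - (x * u) ^+ 2 - x ^+ 2 by ring.
    by rewrite expRD; ring.
  - apply/measurable_EFinP; apply: (measurableT_comp (mq x) (g := *%R x)).
    exact: measurable_funM.
  - by move=> u _; rewrite lee_fin.
  - by rewrite lee_fin (mulr_ge0 _ (ltW x0))// mulr_ge0 ?gauss_fun_ge0.
rewrite -/C step1 ge0_even_integralT//.
(* Moving the restriction [x > 0] into the integrand makes it nonnegative on the whole plane, as
   Tonelli requires. *)
pose G (z : R * R) := (K ^+ 2 * g z.2 z.1 * \1_`]0, +oo[ z.1)%:E.
have mG : measurable_fun setT G.
  apply/measurable_EFinP; apply: measurable_funM; last first.
    exact: measurableT_comp.
  apply: measurable_funM => //.
  have mk : measurable_fun setT (fun z : R * R => (1 + z.2 ^+ 2) * z.1 ^+ 2).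
    apply: measurable_funM; last exact: measurable_funX.
    by apply: measurable_funD => //; exact: measurable_funX.
  apply: measurable_funM; last exact: measurableT_comp.
  apply: measurable_funM => //; apply: measurableT_comp => //.
  exact: measurableT_comp.
have G0 z : (0 <= G z)%E.
  rewrite lee_fin /G indicE mem_setE in_itv/= andbT.
  case: (ltP 0 z.1) => [/ltW z0|_]; last by rewrite mulr0n mulr0.
  by rewrite mulr1n mulr1 mulr_ge0 ?sqr_ge0// /g !mulr_ge0 ?expR_ge0.
transitivity (2%:E * \int[mu]_x \int[mu]_u G (x, u))%E.
  congr (_ * _)%E; rewrite integral_mkcond; apply: eq_integral => x _.
  rewrite patchE mem_setE in_itv/= andbT.
  case: ifPn => x0.
    rewrite step2//; apply: eq_integral => u _.
    by rewrite /G/= indicE mem_setE in_itv/= andbT x0 mulr1.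
  apply/esym; apply: integral0_eq => u _.
  by rewrite /G/= indicE mem_setE in_itv/= andbT (negbTE x0) mulr0.
rewrite (@fubini_tonelli _ _ _ _ _ mu mu G mG G0) muleCA; congr (_ * _)%E.
rewrite -ge0_integralZl//.
- apply: eq_integral => u _.
  have u0 : 0 < 1 + u ^+ 2 by rewrite ltr_pwDl// sqr_ge0.
  transitivity ((K ^+ 2)%:E * \int[mu]_(x in `]0%R, +oo[) (g u x)%:E)%E.
    rewrite -ge0_integralZl//; last 3 first.
    - apply/measurable_EFinP/measurable_funTS.
      have mk : measurable_fun setT (fun x : R => (1 + u ^+ 2) * x ^+ 2).
        exact: measurable_funM.
      apply: measurable_funM; last exact: measurableT_comp.
      apply: measurable_funM => //; apply: measurableT_comp => //.
      exact: measurableT_comp.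
    - move=> x /=; rewrite in_itv/= andbT => /ltW x0.
      by rewrite lee_fin !mulr_ge0 ?expR_ge0.
    - by rewrite lee_fin sqr_ge0.
    rewrite [RHS]integral_mkcond; apply: eq_integral => x _.
    rewrite patchE /G indicE/=; case: ifPn => _; by rewrite ?mulr1 ?mulr0.
  (* The inner integral is the tail formula with [k = 1 + u ^+ 2], whose dependence on [s] is only
     through [expR (- s)]. *)
  rewrite integral_expRsqr_tail// -!EFinM; congr EFin.
  by rewrite mulrCA.
- apply/measurable_EFinP; apply: continuous_measurable_fun => u.
  apply: cvgM; first exact: cvg_cst.
  apply: cvgV; first by rewrite mulf_neq0// gt_eqF// ltr_pwDl// sqr_ge0.
  apply: cvgM; first exact: cvg_cst.
  apply: cvgD; [exact: cvg_cst|exact: exprn_continuous].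
- by move=> u _; rewrite lee_fin divr_ge0 ?sqr_ge0// mulr_ge0// addr_ge0// sqr_ge0.
Qed.

(** The constant left open by the factorisation is the mass of the whole plane, read off at [s = 0].
    The result is the tail of the exponential law of rate 1. *)
Lemma complex_normal_tail (s : R) : 0 <= s ->
  (N \x N)%E [set z | s <= sqnorm z] = (expR (- s))%:E.
Proof.
move=> s0; rewrite complex_normal_tailM//.
have := complex_normal_tailM _ (lexx 0); rewrite oppr0 expR0 mul1e => <-.
have -> : [set z | 0 <= sqnorm z] = setT.
  by apply/seteqP; split => // z _/=; rewrite addr_ge0 ?sqr_ge0.
by rewrite probability_setT mule1.
Qed.

(** This is the Laplace transform of the squared modulus: the exponential splits over the two
    coordinates, each contributing the inverse square root of [1 + b]. *)
Lemma integral_expR_sqnorm (b : R) : 0 <= b ->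
  (\int[N \x N]_z (expR (- (b * sqnorm z)))%:E = (1 + b)^-1%:E)%E.
Proof.
move=> b0.
have m1 : measurable_fun setT (fun x : R => expR (- (b * x ^+ 2))).
  by do 2 apply: measurableT_comp => //; exact: measurable_funM.
rewrite fubini_tonelli1; last 2 first.
- apply/measurable_EFinP; do 2 apply: measurableT_comp => //.
  by apply: measurable_funM => //; exact: measurable_sqnorm.
- by move=> z; rewrite lee_fin expR_ge0.
transitivity (\int[N]_x
    ((expR (- (b * x ^+ 2)))%:E * (Num.sqrt (1 + b))^-1%:E))%E.
  apply: eq_integral => x _; rewrite /fubini_F -integral_expRsqr_normal//.
  rewrite -ge0_integralZl//.
  - by apply: eq_integral => y _; rewrite -EFinM -expRD /sqnorm mulrDr opprD.
  - exact/measurable_EFinP.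
rewrite ge0_integralZr//; last first.
  exact/measurable_EFinP.
rewrite integral_expRsqr_normal// -EFinM -invfM -expr2 sqr_sqrtr//.
by rewrite addr_ge0.
Qed.

End complex_normal.

(** * From independence on rectangles to product laws *)

Section joint_law.
Context {R : realType} {d d1 d2 : measure_display}.
Context {T : measurableType d} {T1 : measurableType d1} {T2 : measurableType d2}.
Variables (P : probability T R) (m1 : probability T1 R) (m2 : probability T2 R).
Local Open Scope ereal_scope.

(* Since [c = P E], dividing by [c] reduces this to the uniqueness of the product
   measure unless [c = 0]. *)
Lemma joint_law_setI (X : T -> T1) (Y : T -> T2) (E : set T) (c : \bar R) :
  measurable_fun setT X -> measurable_fun setT Y -> measurable E ->
  (forall A B, measurable A -> measurable B ->
    P (E `&` (X @^-1` A `&` Y @^-1` B)) = c * (m1 A * m2 B)) ->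
  forall C, measurable C ->
    P (E `&` (fun t => (X t, Y t)) @^-1` C) = c * (m1 \x m2) C.
Proof.
move=> mX mY mE H C mC.
have PE : P E = c.
  have := H _ _ measurableT measurableT.
  by rewrite !preimage_setT !setIT !probability_setT !mule1.
have mXY : measurable_fun setT (fun t => (X t, Y t)) by exact: measurable_fun_pair.
have mXYC D : measurable D -> measurable ((fun t => (X t, Y t)) @^-1` D).
  by move=> mD; rewrite -[X in measurable X]setTI; exact: mXY.
have cfin : c \is a fin_num by rewrite -PE fin_num_measure.
have [c0|c0] := eqVneq (fine c) 0%R.
  have {}c0 : c = 0 by rewrite -(fineK cfin) c0.
  rewrite c0 mul0e; apply/eqP; rewrite -measure_le0 -c0 -PE.
  by apply: le_measure; rewrite ?inE//; apply: measurableI => //; exact: mXYC.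
have c_ge0 : (0 <= (fine c)^-1)%R by rewrite invr_ge0 -PE fine_ge0.
have [m mE'] : {m : {measure set (T1 * T2) -> \bar R} |
    (m : set _ -> _) = pushforward (mrestr P mE) (fun t => (X t, Y t))}.
  by unshelve eexists (pushforward (mrestr P mE) (fun t => (X t, Y t))).
rewrite (product_measure_unique (m' := mscale (NngNum c_ge0) m))//=.
  rewrite /mscale/= mE' /pushforward /mrestr muleA -{1}(fineK cfin) -EFinM.
  by rewrite divff// mul1e setIC.
move=> A B mA mB; rewrite /mscale/= mE' /pushforward /mrestr setIC.
have -> : (fun t => (X t, Y t)) @^-1` (A `*` B) = X @^-1` A `&` Y @^-1` B by [].
by rewrite H// muleA -{2}(fineK cfin) -EFinM mulVf// mul1e.
Qed.

Lemma joint_law_bigcap (n : nat) (X : 'I_n -> T -> T1) (Y : 'I_n -> T -> T2) :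
  (forall k, measurable_fun setT (X k)) -> (forall k, measurable_fun setT (Y k)) ->
  (forall (A : 'I_n -> set T1) (B : 'I_n -> set T2),
    (forall k, measurable (A k)) -> (forall k, measurable (B k)) ->
    P (\bigcap_(k in [set: 'I_n]) (X k @^-1` A k `&` Y k @^-1` B k)) =
    \prod_(k < n) (m1 (A k) * m2 (B k))) ->
  forall C : 'I_n -> set (T1 * T2), (forall k, measurable (C k)) ->
    P (\bigcap_(k in [set: 'I_n]) (fun t => (X k t, Y k t)) @^-1` C k) =
    \prod_(k < n) (m1 \x m2) (C k).
Proof.
(* Rectangles are replaced by arbitrary measurable sets one index at a time. *)
move=> mX mY H C mC.
pose Z k t := (X k t, Y k t).
have mZ k D : measurable D -> measurable (Z k @^-1` D).
  move=> mD; rewrite -[X in measurable X]setTI.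
  exact: measurable_fun_pair.
(* Invariant: sets with index below [j] are arbitrary, the others are rectangles. At [j = 0] this is
   the hypothesis [H]; at [j = n] the rectangle condition is vacuous. *)
suff S j : (j <= n)%N -> forall C : 'I_n -> set (T1 * T2),
    (forall k, measurable (C k)) ->
    (forall k : 'I_n, (j <= k)%N ->
      exists A B, [/\ measurable A, measurable B & C k = A `*` B]) ->
    P (\bigcap_(k in [set: 'I_n]) Z k @^-1` C k) =
    \prod_(k < n) (m1 \x m2) (C k).
  apply: (S n) => // k; by rewrite leqNgt ltn_ord.
elim: j => [_ {}C {}mC rC|j IH jn {}C {}mC rC].
  have /choice[AB hAB] : forall k, exists AB : set T1 * set T2,
      [/\ measurable AB.1, measurable AB.2 & C k = AB.1 `*` AB.2].
    by move=> k; have [A [B ?]] := rC k (leq0n _); exists (A, B).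
  rewrite (eq_bigr (fun k => m1 (AB k).1 * m2 (AB k).2)); last first.
    by move=> k _; have [mA mB ->] := hAB k; rewrite product_measure1E.
  have mA k : measurable (AB k).1 by have [] := hAB k.
  have mB k : measurable (AB k).2 by have [] := hAB k.
  rewrite -H//.
  by congr (P _); apply: eq_bigcapr => k _; have [_ _ ->] := hAB k.
pose i := Ordinal jn.
have split_i D : \bigcap_(k in [set: 'I_n]) Z k @^-1` D k =
    \bigcap_(k in [set k | k != i]) Z k @^-1` D k `&` Z i @^-1` D i.
  apply/seteqP; split => t /=.
    by move=> h; split; [move=> k _; exact: h|exact: h].
  by move=> [h hi] k _; have [->//|ki] := eqVneq k i; exact: h.
(* The set at index [i] is freed while the events at all other indices are held fixed: their
   intersection serves as [E], the product of their laws as [c]. *)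
rewrite split_i (bigD1 i)//= muleC.
apply: joint_law_setI => //.
  by apply: fin_bigcap_measurable => // k _; exact: mZ.
move=> A B mA mB.
(* With a rectangle put back at index [i], the family meets the rectangle condition from [j] on, so
   the induction hypothesis applies. *)
pose D k := if k == i then A `*` B else C k.
have Di : D i = A `*` B by rewrite /D eqxx.
have Dk k : k != i -> D k = C k by rewrite /D => /negbTE ->.
have -> : \bigcap_(k in [set k | k != i]) Z k @^-1` C k `&`
    (X i @^-1` A `&` Y i @^-1` B) = \bigcap_(k in [set: 'I_n]) Z k @^-1` D k.
  rewrite split_i Di; congr (_ `&` _).
  by apply: eq_bigcapr => k /Dk ->.
rewrite IH; first last.
- move=> k jk; have [->|ki] := eqVneq k i; first by exists A, B; rewrite Di.
  rewrite Dk//; apply: rC; rewrite ltn_neqAle jk andbT.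
  by apply: contra ki => /eqP jk'; apply/eqP/val_inj.
- move=> k; have [->|ki] := eqVneq k i; last by rewrite Dk.
  by rewrite Di; exact: measurableX.
- exact: ltnW.
rewrite (bigD1 i)//= muleC Di product_measure1E//; congr (_ * _).
by apply: eq_bigr => k /Dk ->.
Qed.

End joint_law.

(** * The success probability of a single hop *)

Section complex_normal_pair.
Context {R : realType}.
Local Notation N := (normal_prob 0 (Num.sqrt (2^-1 : R))).

Lemma measurable_sqnorm_affine (a b : R) :
  measurable [set p : (R * R) * (R * R) | a + b * sqnorm p.1 <= sqnorm p.2].
Proof.
pose f (p : (R * R) * (R * R)) := sqnorm p.2 - (a + b * sqnorm p.1).
have mf : measurable_fun setT f.
  apply: measurable_funB.
    by apply: measurableT_comp => //; exact: measurable_sqnorm.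
  apply: measurable_funD => //; apply: measurable_funM => //.
  by apply: measurableT_comp => //; exact: measurable_sqnorm.
have -> : [set p | a + b * sqnorm p.1 <= sqnorm p.2] = f @^-1` `[0, +oo[.
  by apply/seteqP; split => p/=; rewrite in_itv/= andbT subr_ge0.
by rewrite -[X in measurable X]setTI; exact: mf.
Qed.

(** The eavesdropper's channel is the first coordinate because [product_measure1] integrates the
    measures of sections over it: each section is an exponential tail, and the Laplace transform
    finishes. *)
Lemma complex_normal_affine_tail (a b : R) : 0 <= a -> 0 <= b ->
  ((N \x N) \x (N \x N))%E [set p | a + b * sqnorm p.1 <= sqnorm p.2] =
  (expR (- a) / (1 + b))%:E.
Proof.
move=> a0 b0; set D := (X in _ X = _).
have sq0 z : 0 <= sqnorm z :> R by rewrite addr_ge0 ?sqr_ge0.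
transitivity (\int[N \x N]_w
    ((expR (- a))%:E * (expR (- (b * sqnorm w)))%:E))%E.
  rewrite [LHS]/product_measure1; apply: eq_integral => w _ /=.
  have -> : xsection D w = [set z | a + b * sqnorm w <= sqnorm z].
    by apply/seteqP; split => z; rewrite xsectionP.
  rewrite complex_normal_tail; last by rewrite addr_ge0// mulr_ge0.
  by rewrite -EFinM -expRD opprD.
rewrite ge0_integralZl//.
- by rewrite integral_expR_sqnorm// -EFinM.
- apply/measurable_EFinP; do 2 apply: measurableT_comp => //.
  by apply: measurable_funM => //; exact: measurable_sqnorm.
Qed.

End complex_normal_pair.

(** * The outage event and its probability *)

Lemma le_log2_ratio (R : realType) (g gE Rs z w : R) :
  0 < g -> 0 < gE -> 0 <= z -> 0 <= w ->
  (Rs <= log2 ((1 + g * z) / (1 + gE * w))) =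
  ((2 `^ Rs - 1) / g + 2 `^ Rs / g * gE * w <= z).
Proof.
move=> g0 gE0 z0 w0.
have v0 : 0 < 1 + gE * w by rewrite ltr_pwDl// mulr_ge0// ltW.
have u0 : 0 < 1 + g * z by rewrite ltr_pwDl// mulr_ge0// ltW.
have ln2_gt0 : 0 < ln 2 :> R by rewrite ln_gt0// ltr1n.
(* Multiplying by [ln 2 > 0], exponentiating and clearing the positive denominator leaves an
   inequality affine in [z] and [w]. *)
rewrite /log2 ler_pdivlMr// -ler_expR lnK ?posrE ?divr_gt0//.
have -> : expR (Rs * ln 2) = 2 `^ Rs by rewrite /powR pnatr_eq0.
rewrite ler_pdivlMr//.
have -> : (2 `^ Rs - 1) / g + 2 `^ Rs / g * gE * w =
    (2 `^ Rs * (1 + gE * w) - 1) / g by field; rewrite gt_eqF.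
by rewrite ler_pdivrMr// lerBlDl (mulrC z).
Qed.

Theorem theorem7 (R : realType) (d : measure_display) (T : measurableType d)
  (P : probability T R) (hre him : 'I_4 -> T -> R)
  (gR gD gE Rs : R) :
  0 < gR -> 0 < gD -> 0 < gE -> 0 < Rs ->
  indep_CN01 P hre him ->
  P [set t | secrecy_R3 gR gD gE hre him t < Rs] =
  (1 - expR (- ((2 `^ Rs - 1) / gD) - (2 `^ Rs - 1) / gR)
       * (1 + 2 `^ Rs / gD * gE)^-1
       * (1 + 2 `^ Rs / gR * gE)^-1)%:E.
Proof.
move=> gR0 gD0 gE0 Rs0 [mre [mim indep]].
pose N : probability _ R := normal_prob 0 (Num.sqrt (2^-1 : R)).
pose Z k t := (hre k t, him k t).
have mZ k : measurable_fun setT (Z k) by exact: measurable_fun_pair.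
(* Real and imaginary parts are merged first, giving four independent complex variables. *)
have lawZ C : (forall k, measurable (C k)) ->
    P (\bigcap_(k in [set: 'I_4]) Z k @^-1` C k) = (\prod_(k < 4) (N \x N) (C k))%E.
  exact: (joint_law_bigcap P N N _ hre him mre mim indep C).
pose o1 : 'I_2 := lift ord0 ord0.
have I2P (Q : 'I_2 -> Prop) : Q ord0 -> Q o1 -> forall i, Q i.
  by move=> q0 q1 [[|[|//]]] i2; [move: q0|move: q1]; congr Q; exact: val_inj.
(* The hops are indexed by ['I_2], source to relay first: [s] picks the legitimate channel, [e] the
   eavesdropper's and [g] the average SNR. *)
pose s (i : 'I_2) := if i == ord0 then iSR else iRD.
pose e (i : 'I_2) := if i == ord0 then iSE else iRE.
pose g (i : 'I_2) := if i == ord0 then gR else gD.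
have g0 i : 0 < g i by rewrite /g; case: ifP.
pose a i := (2 `^ Rs - 1) / g i.
pose b i := 2 `^ Rs / g i * gE.
have a0 i : 0 <= a i.
  apply: divr_ge0; last exact: ltW.
  by rewrite subr_ge0 -[leLHS](powRr0 2) ler_powR ?ler1n// ltW.
have b0 i : 0 <= b i by rewrite mulr_ge0 ?divr_ge0 ?powR_ge0// ltW.
pose D i : set ((R * R) * (R * R)) :=
  [set p | a i + b i * sqnorm p.1 <= sqnorm p.2].
have mD i : measurable (D i) by exact: measurable_sqnorm_affine.
(* The same merging principle, one level up, groups the four complex variables into two independent
   pairs, one per hop. *)
have lawW : P (\bigcap_(i in [set: 'I_2]) (fun t => (Z (e i) t, Z (s i) t)) @^-1` D i) =
    (\prod_(i < 2) ((N \x N) \x (N \x N)) (D i))%E.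
  apply: (joint_law_bigcap P (N \x N)%E (N \x N)%E _ (Z \o e) (Z \o s)) => [i|i|A B mA mB|//].
  - exact: mZ.
  - exact: mZ.
  (* The list follows the numbering SR, RD, SE, RE; [B] constrains the legitimate channels and [A]
     the eavesdropper's. *)
  pose C (k : 'I_4) := nth set0 [:: B ord0; B o1; A ord0; A o1] k.
  have mC k : measurable (C k) by case: k => -[|[|[|[|//]]]] k4; rewrite /C/=.
  have -> : \bigcap_(i in [set: 'I_2]) (Z (e i) @^-1` A i `&` Z (s i) @^-1` B i) =
      \bigcap_(k in [set: 'I_4]) (Z k @^-1` C k).
    apply/seteqP; split => t h.
      have [h2 h0] := h ord0 I; have [h3 h1] := h o1 I.
      move=> [[|[|[|[|//]]]]] k4 _.
      - by rewrite (_ : Ordinal k4 = iSR)//; exact: val_inj.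
      - by rewrite (_ : Ordinal k4 = iRD)//; exact: val_inj.
      - by rewrite (_ : Ordinal k4 = iSE)//; exact: val_inj.
      - by rewrite (_ : Ordinal k4 = iRE)//; exact: val_inj.
    move=> i _; elim/I2P: i; split.
    - exact: (h iSE I).
    - exact: (h iSR I).
    - exact: (h iRE I).
    - exact: (h iRD I).
  have prodC (m : set (R * R) -> \bar R) :
      (\prod_(k < 4) m (C k) = \prod_(i < 2) (m (A i) * m (B i)))%E.
    rewrite !big_ord_recl !big_ord0 /= !mule1 /C /=.
    by rewrite [RHS]muleACA [RHS]muleC [LHS]muleA.
  by rewrite lawZ// prodC.
have -> : [set t | secrecy_R3 gR gD gE hre him t < Rs] =
    ~` (\bigcap_(i in [set: 'I_2]) (fun t => (Z (e i) t, Z (s i) t)) @^-1` D i).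
  rewrite -[LHS]setCK; congr (~` _); apply/seteqP.
  have z0 k t : 0 <= abs2 hre him k t by rewrite addr_ge0 ?sqr_ge0.
  have E t : (~ (secrecy_R3 gR gD gE hre him t < Rs)) <->
      (a ord0 + b ord0 * abs2 hre him iSE t <= abs2 hre him iSR t) /\
      (a o1 + b o1 * abs2 hre him iRE t <= abs2 hre him iRD t).
    (* As [Rs > 0], the bound [Rs <= max(x, 0)] amounts to [Rs <= x], and the minimum then splits
       into one condition per hop. *)
    rewrite (rwP negP) -leNgt /secrecy_R3 le_max (leNgt Rs 0) Rs0 orbF le_min.
    by rewrite !le_log2_ratio// (rwP andP).
  split => t /=.
    by move=> /E[h0 h1] i _; elim/I2P: i.
  by move=> h; apply/E; split; [exact: (h ord0 I)|exact: (h o1 I)].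
rewrite probability_setC; last first.
  apply: fin_bigcap_measurable => // i _; rewrite -[X in measurable X]setTI.
  exact: measurable_fun_pair.
rewrite lawW (eq_bigr (fun i => (expR (- a i) / (1 + b i))%:E)); last first.
  by move=> i _; exact: complex_normal_affine_tail.
rewrite !big_ord_recl big_ord0 mule1 -EFinM -EFinB; congr (1 - _)%:E.
by rewrite expRD /a /b /g /=; ring.
Qed.
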